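(* Let $d\ge 1$ and let $(P_n)_{n\ge 1}$ be a sequence of elements of $\mathscr{P}_d$. Then the infinite product $$\prod_{n\ge 1}\beta(P_n)\,\frac{P_n^*}{P_n}$$ converges uniformly on compact subsets of $\mathbb{D}^d$ if and only if $$\sum_{n\ge 1}\bigl(1-|\alpha(P_n)|\bigr)<+\infty .$$ Here convergence of the infinite product means that the partial products converge, uniformly on compact subsets of $\mathbb{D}^d$, to a function that is not identically zero.
   Context: $\mathbb{D}=\{z\in\mathbb{C}: |z|<1\}$, and $\partial^*\mathbb{D}^d=\{z\in\mathbb{C}^d: |z_1|=\dots=|z_d|=1\}$ is the distinguished boundary of the polydisk $\mathbb{D}^d$. For a nonzero polynomial $P\in\mathbb{C}[z_1,\dots,z_d]$, let $\mathrm{d}^\circ P=(m_1,\dots,m_d)$, where $m_i$ is the degree of $P$ with respect to $z_i$; let $\overline{P}$ be the polynomial obtained from $P$ by replacing each coefficient by its complex conjugate; and let $P^*(z)=z_1^{m_1}\cdots z_d^{m_d}\,\overline{P}(z_1^{-1},\dots,z_d^{-1})$. The set $\mathscr{P}_d$ consists of the non-constant polynomials $P\in\mathbb{C}[z_1,\dots,z_d]$ that have no zeros in $\mathbb{D}^d\cup\partial^*\mathbb{D}^d$ and have no (non-constant) common factor with $P^*$. For $P\in\mathscr{P}_d$, set $\alpha(P)=P^*(0)/P(0)$, and $\beta(P)=\overline{\alpha(P)}/|\alpha(P)|$ if $\alpha(P)\neq 0$, $\beta(P)=1$ otherwise. *)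

(* Defs.v *)
From mathcomp Require Import all_boot all_order all_algebra.
From mathcomp Require Import complex.
From mathcomp Require Import all_classical all_reals all_analysis.
(* The notations of mpoly clash with those of MathComp-Analysis. *)
From mathcomp Require Export -(notations) mpoly.

Set Implicit Arguments.
Unset Strict Implicit.
Unset Printing Implicit Defensive.

Import Order.TTheory GRing.Theory Num.Theory.
Import numFieldNormedType.Exports.

Local Open Scope classical_set_scope.
Local Open Scope ring_scope.

Section Defs.
Context {C : numClosedFieldType} {d : nat}.
Implicit Types (P Q : mpoly d C) (z : 'rV[C]_d).

Definition polydisk : set 'rV[C]_d := [set z | forall i, `|z ord0 i| < 1].

Definition distinguished_boundary : set 'rV[C]_d :=
  [set z | forall i, `|z ord0 i| = 1].

Definition evalv P z : C := meval (fun i => z ord0 i) P.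

Definition multidegree P : multinom d :=
  Multinom [tuple \max_(m <- msupp P) m i | i < d].

Definition conj_mpoly P : mpoly d C := map_mpoly (fun c : C => c^*) P.

(* z_1^m_1 ... z_d^m_d \bar P (z_1^-1, ..., z_d^-1), with the monomial
   multiplied into each term; see [reflectionE]. *)
Definition reflection P : mpoly d C :=
  \sum_(m <- msupp (conj_mpoly P))
    mcoeff m (conj_mpoly P) *: mpolyX C (mnm_sub (multidegree P) m).

Lemma reflectionE P z : (forall i, z ord0 i != 0) ->
  evalv (reflection P) z =
  (\prod_(i < d) z ord0 i ^+ multidegree P i) *
    evalv (conj_mpoly P) (\row_i (z ord0 i)^-1).
Proof.
move=> z0; rewrite /evalv /reflection raddf_sum /= mevalE big_distrr /=.
rewrite big_seq [RHS]big_seq; apply: eq_bigr => m.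
rewrite mcoeff_msupp => Pm.
rewrite mevalZ mevalX mulrCA; congr (_ * _).
rewrite -big_split /=; apply: eq_bigr => i _.
have mle : (m i <= multidegree P i)%N.
  rewrite mnmE; apply: (@leq_bigmax_seq _ _ _ (fun m : multinom d => m i)) => //.
  rewrite mcoeff_msupp; apply: contraNneq Pm => Pm0.
  by rewrite /conj_mpoly mcoeff_map_mpoly /= Pm0 rmorph0.
by rewrite mxE mnmBE exprVn expfB_cond // (negbTE (z0 i)).
Qed.

Definition nonconstant P : Prop := forall c : C, P <> mpolyC d c.

Definition mdivides Q P : Prop := exists A : mpoly d C, P = A * Q.

Definition admissible P : Prop :=
  [/\ nonconstant P,
      forall z, (polydisk `|` distinguished_boundary) z -> evalv P z != 0 &
      forall Q, mdivides Q P -> mdivides Q (reflection P) -> ~ nonconstant Q].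

Definition alpha P : C := evalv (reflection P) 0 / evalv P 0.

Definition beta P : C :=
  if alpha P == 0 then 1 else (alpha P)^* / `|alpha P|.

(* Only the values on the polydisk of the factors [f n] and of the limit [g]
   matter. *)
Definition infinite_product_converges (f : nat -> 'rV[C]_d -> C) : Prop :=
  exists g : 'rV[C]_d -> C,
    {family [set K | compact K /\ K `<=` polydisk],
      (fun N z => \prod_(n < N) f n z) @ \oo --> g} /\
    exists2 z, polydisk z & g z != 0.

End Defs.

(* Main.v *)
Require Import Defs.
From mathcomp Require Import all_boot all_order all_algebra.
From mathcomp Require Import complex.
From mathcomp Require Import all_classical all_reals all_analysis.
From mathcomp Require Import ring.
Import Order.TTheory GRing.Theory Num.Theory.
Import numFieldNormedType.Exports.
Local Open Scope classical_set_scope.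
Local Open Scope ring_scope.

(** Write f for beta(P) P*/P and a = f(0) = |alpha(P)|.  Everything rests on a
    Schwarz-Pick inequality between 0 and a point z of the polydisk: if all
    |z_i| < r < 1, then |f(z)| <= 1 and
      |f(z) - a| <= r |1 - a f(z)|     ([schwarz_pick_inner_factor]).
    Elementary manipulations turn it into two comparisons,
      |1 - f(z)| <= (1 + r) / (1 - r) (1 - a)      and
      (1 - r^2) (1 - a) <= 4 (1 - |f(z)|).

    If the product converges to a limit that is not zero at z, the moduli of
    the partial products at z decrease to a positive number, so the sum of the
    1 - |f_n(z)| is finite by telescoping, and the second comparison makes the
    sum of the 1 - a_n finite.  Conversely, if this last sum is finite, the
    first comparison bounds the difference of two partial products G_M, G_N by
    |G_M| times a constant times a tail of the sum, uniformly for |z_i| < r.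
    This gives locally uniform convergence; and since the error is relative to
    |G_M|, the limit is nonzero at any point where a G_M with M large is
    nonzero ([exists_reflections_neq0] provides one).

    The Schwarz-Pick inequality is proved without maximum principle, by
    algebra over the complex numbers.  For a univariate polynomial p of formal
    degree n without zeros in the unit disk, splitting p into linear factors
    gives |p*| <= |p| in the disk ([ler_norm_revconj]); applied to the
    combination conj(p(0)) p - conj(p*(0)) p*, whose degree is smaller than n,
    this same inequality is Schwarz-Pick ([schwarz_pick_revconj]).  For d
    variables, the map
      t |-> t (u_i + m(t)) / (1 + conj(u_i) m(t)),
      m(t) = (t - r) / (1 - r t),   u_i = z_i / r,
    sends the disk into the polydisk and the circle into the distinguished
    boundary, 0 to 0 and r to z.  Substituting it into P and clearing
    denominators gives a univariate polynomial without zeros in the disk,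
    and this operation commutes with the reflection ([revconj_slice]). *)

(** * Univariate reflections and the Schwarz-Pick inequality *)

Section UnivariateSchwarzPick.
Context {C : numClosedFieldType}.
Implicit Types (p q : {poly C}) (t a c : C) (n : nat).

(** The reflection of [p] with respect to the formal degree [n], which may
    exceed the degree of [p]: that is [t^n conj(p(1/conj t))] for [t != 0]. *)
Definition revconj n p : {poly C} := \poly_(i < n.+1) (p`_(n - i))^*.

Lemma exists_nonroot p (x : nat -> C) : p != 0 -> injective x ->
  exists k, p.[x k] != 0.
Proof.
move=> p0 x_inj; have [[k xk] | allroot] := pselect (exists k, p.[x k] != 0).
  by exists k.
have := max_poly_roots p0 (rs := [seq x k | k <- iota 0 (size p)]).
rewrite size_map size_iota ltnn map_inj_uniq ?iota_uniq // => noroots.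
suff /noroots/(_ isT) : all (root p) [seq x k | k <- iota 0 (size p)] by [].
apply/allP => _ /mapP[k _ ->]; apply/negPn/negP => xk.
by apply: allroot; exists k.
Qed.

Lemma poly_eq_off0 p q : (forall t, t != 0 -> p.[t] = q.[t]) -> p = q.
Proof.
move=> pq; apply/eqP; rewrite -subr_eq0; apply/negPn/negP => pq0.
have /(exists_nonroot _ _ pq0) : injective (fun k : nat => k.+1%:R : C).
  by move=> i j /eqP; rewrite eqr_nat eqSS => /eqP.
by case=> k; rewrite hornerD hornerN pq ?subrr ?eqxx // pnatr_eq0.
Qed.

Lemma horner_revconj n p t : (size p <= n.+1)%N -> t != 0 ->
  (revconj n p).[t] = t ^+ n * (p.[(t^*)^-1])^*.
Proof.
move=> sp t0; rewrite horner_poly (horner_coef_wide _ sp) rmorph_sum mulr_sumr.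
rewrite (reindex_inj rev_ord_inj) /=; apply: eq_bigr => i _.
rewrite subSS subKn ?rmorphM ?rmorphXn ?fmorphV ?conjCK -1?ltnS //.
rewrite /= exprVn expfB_cond ?(negbTE t0) ?add0n -1?ltnS ?ltn_ord // conjCK.
by rewrite mulrCA.
Qed.

Lemma revconjK n p : (size p <= n.+1)%N -> revconj n (revconj n p) = p.
Proof.
move=> sp; apply/polyP => i; rewrite coef_poly ltnS.
case: leqP => [le_in|lt_ni]; last first.
  by rewrite nth_default // (leq_trans sp).
by rewrite coef_poly ltnS leq_subr subKn // conjCK.
Qed.

Lemma revconj0 n p : (revconj n p).[0] = (p`_n)^*.
Proof. by rewrite horner_coef0 coef_poly /= subn0. Qed.

(** The reflection of a factor [X - a] is [1 - conj a X]; the surplus of the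
    formal degree [n] over the degree goes into a power of [X]. *)
Lemma revconj_prod_XsubC n c (rs : seq C) : (size rs <= n)%N ->
  revconj n (c *: \prod_(a <- rs) ('X - a%:P)) =
  c^* *: ('X^(n - size rs) * \prod_(a <- rs) (1 - a^* *: 'X)).
Proof.
move=> srs; apply: poly_eq_off0 => t t0; rewrite horner_revconj //; last first.
  by rewrite (leq_trans (size_scale_leq _ _)) // size_prod_XsubC ltnS.
rewrite !hornerZ hornerM hornerXn !horner_prod rmorphM rmorph_prod mulrCA.
congr (_ * _).
have -> : t ^+ n = t ^+ (n - size rs) * t ^+ size rs by rewrite -exprD subnK.
rewrite -mulrA; congr (_ * _).
elim: rs {srs} => [|a rs IH]; first by rewrite !big_nil mulr1.
rewrite !big_cons -IH /= exprS mulrACA !hornerE rmorphB fmorphV /= conjCK.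
by rewrite mulrBr divff // [t * _]mulrC.
Qed.

(** Both sides are [0] when [a] or [t] is on the unit circle; this identity
    is what makes Blaschke factors contractive. *)
Lemma normB_1subMconj a t :
  `|1 - a^* * t| ^+ 2 - `|t - a| ^+ 2 = (1 - `|a| ^+ 2) * (1 - `|t| ^+ 2).
Proof. by rewrite !normCK !rmorphB !rmorphM rmorph1 /= conjCK; ring. Qed.

Lemma ler_norm_1subMconj a t : 1 <= `|a| -> `|t| <= 1 ->
  `|1 - a^* * t| <= `|t - a|.
Proof.
move=> a1 t1; rewrite -ler_sqr ?nnegrE // -subr_le0 normB_1subMconj.
by rewrite mulr_le0_ge0 // ?subr_le0 ?subr_ge0 ?expr_ge1 ?expr_le1.
Qed.


Lemma factor_nonvanishing_disk p : (forall t, `|t| < 1 -> p.[t] != 0) ->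
  exists c (rs : seq C), [/\ c != 0, {in rs, forall a, 1 <= `|a|},
    size p = (size rs).+1 & p = c *: \prod_(a <- rs) ('X - a%:P)].
Proof.
move=> p0; have [rs Dp] := closed_field_poly_normal p.
have c0 : lead_coef p != 0.
  rewrite lead_coef_eq0; apply/eqP => pE; move: (p0 0).
  by rewrite pE horner0 normr0 ltr01 eqxx => /(_ isT).
exists (lead_coef p), rs; split=> // [a ars|].
  rewrite real_leNgt ?normr_real ?real1 //; apply/negP => /p0/negP; apply.
  by rewrite Dp hornerZ mulf_eq0 -[_.[a] == 0]rootE root_prod_XsubC ars orbT.
by rewrite {1}Dp size_scale // size_prod_XsubC.
Qed.

(** The roots [a] satisfy [1 <= `|a|], so each factor [1 - conj a t] of the
    reflection is dominated by the factor [t - a] of [p]. *)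
Lemma ler_norm_revconj n p t : (size p <= n.+1)%N ->
  (forall t, `|t| < 1 -> p.[t] != 0) -> `|t| < 1 ->
  `|(revconj n p).[t]| <= `|p.[t]|.
Proof.
move=> sp /factor_nonvanishing_disk[c [rs [c0 rs1 spE Dp]]] /ltW t1.
rewrite spE ltnS in sp; rewrite Dp revconj_prod_XsubC //.
rewrite !hornerZ hornerM hornerXn !horner_prod !normrM norm_conjC ler_wpM2l //.
rewrite -[leRHS]mul1r ler_pM // ?normrX ?exprn_ile1 //.
elim: rs rs1 {spE Dp sp} => [|a rs IH] rs1; first by rewrite !big_nil.
rewrite !big_cons !hornerE !normrM ler_pM //.
  by rewrite ler_norm_1subMconj // rs1 // mem_head.
by rewrite IH // => b brs; rewrite rs1 // inE brs orbT.
Qed.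

(** Equality at the origin forces the formal degree to be the degree and all
    the roots to be on the unit circle, where [1 - conj a X] and [X - a] are
    proportional. *)
Lemma revconj_self_proportional n p : (size p <= n.+1)%N ->
  (forall t, `|t| < 1 -> p.[t] != 0) ->
  `|(revconj n p).[0]| = `|p.[0]| -> exists k, revconj n p = k *: p.
Proof.
move=> sp /factor_nonvanishing_disk[c [rs [c0 rs1 spE Dp]]].
rewrite spE ltnS in sp; rewrite Dp revconj_prod_XsubC //.
rewrite !hornerZ hornerM hornerXn !horner_prod !normrM norm_conjC => /mulfI.
rewrite normr_eq0 => /(_ c0).
under eq_bigr do rewrite !hornerE ?mulr0 ?subr0.
rewrite big1_eq normr1 mulr1 normr_prod.
under [in RHS]eq_bigr do rewrite !hornerE ?sub0r normrN.
(* A positive power of 0 would make the left side 0, while all roots are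
   nonzero. *)
case: (posnP (n - size rs)) => [-> E|n0]; last first.
  rewrite expr0n -leqn0 leqNgt n0 normr0 => /esym/eqP.
  rewrite prodf_seq_eq0 => /hasP[a /rs1 + /= /eqP a0].
  by rewrite a0 ler10.
move: E; rewrite expr0 normr1 => /esym E.
have {E} : {in rs, forall a, `|a| = 1}.
  elim: rs rs1 E {spE Dp sp} => [//|a rs IH] rs1.
  have rs1' : {in rs, forall b, 1 <= `|b|}.
    by move=> b brs; rewrite rs1 // inE brs orbT.
  have a1 : 1 <= `|a| by rewrite rs1 ?mem_head.
  have p1 : 1 <= \prod_(b <- rs) `|b|.
    rewrite big_seq; elim/big_ind: _ => // x y x1 y1.
    by rewrite -[1]mulr1 ler_pM.
  rewrite big_cons => E.
  have aE : `|a| = 1.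
    by apply/eqP; rewrite eq_le a1 andbT -E ler_peMr.
  move: E; rewrite aE mul1r => /(IH rs1') H b.
  by rewrite inE => /predU1P[->//|/H].
move=> {}rs1; rewrite expr0 mul1r.
exists (c^* * (\prod_(a <- rs) (- a^*)) / c).
rewrite scalerA divfK // -scalerA; congr (_ *: _).
elim: rs rs1 {spE Dp sp} => [|a rs IH] rs1; first by rewrite !big_nil scale1r.
rewrite !big_cons -scalerA scalerAr -IH; last first.
  by move=> b brs; rewrite rs1 // inE brs orbT.
rewrite scalerAl; congr (_ * _).
have aa : a^* * a = 1.
  by rewrite mulrC -normCK rs1 ?mem_head // expr1n.
by rewrite scaleNr scalerBr opprB -[_ *: a%:P]mul_polyC -polyCM aa.
Qed.

(** When [|p*(0)| < |p(0)|], the combination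
    [q = conj (p 0) p - conj (p* 0) p*] has no zero in the disk either, and its
    reflection [p(0) p* - p*(0) p] vanishes at the origin, that is, [q] has
    degree less than [n]; lowering the formal degree to [n - 1] gains the
    factor [t]. *)
Lemma schwarz_pick_revconj n p t : (size p <= n.+1)%N ->
  (forall t, `|t| < 1 -> p.[t] != 0) -> `|t| < 1 ->
  `|p.[0] * (revconj n p).[t] - (revconj n p).[0] * p.[t]| <=
  `|t| * `|p.[0]^* * p.[t] - (revconj n p).[0]^* * (revconj n p).[t]|.
Proof.
move=> sp p0 t1; set ps := revconj n p.
have [/(revconj_self_proportional n p sp p0)[k]|neq] :=
    eqVneq `|ps.[0]| `|p.[0]|.
  rewrite -/ps => ->; rewrite !hornerZ [_ - _](_ : _ = 0) ?normr0 ?mulr_ge0 //.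
  by ring.
have [->|t0] := eqVneq t 0; first by rewrite mulrC subrr normr0 mul0r.
have lt0 : `|ps.[0]| < `|p.[0]|.
  by rewrite lt_neqAle neq ler_norm_revconj ?normr0 ?ltr01.
have sps : (size ps <= n.+1)%N by exact: size_poly.
pose q := p.[0]^* *: p - ps.[0]^* *: ps.
have qE s : q.[s] = p.[0]^* * p.[s] - ps.[0]^* * ps.[s] by rewrite !hornerE.
have q0 s : `|s| < 1 -> q.[s] != 0.
  move=> s1; rewrite qE subr_eq0; apply/eqP => /(congr1 (@Num.norm _ _)).
  rewrite !normrM !norm_conjC => E.
  have : `|ps.[0]| * `|ps.[s]| < `|p.[0]| * `|p.[s]|.
    apply: le_lt_trans (_ : `|ps.[0]| * `|p.[s]| < _).
      by rewrite ler_wpM2l // ler_norm_revconj.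
    by rewrite ltr_pM2r // normr_gt0 p0.
  by rewrite E ltxx.
have qn : q`_n = 0.
  rewrite coefB !coefZ coef_poly leqnn subnn -horner_coef0.
  by rewrite -[p`_n]conjCK -revconj0 -/ps mulrC subrr.
(* For n = 0 the polynomial is constant and the strict inequality fails. *)
case: n => [|n] in sp ps neq lt0 sps q qE q0 qn *.
  have /size1_polyC pE := sp.
  by move: neq; rewrite /ps revconj0 pE !hornerE coefC norm_conjC eqxx.
have sq : (size q <= n.+1)%N.
  apply/leq_sizeP => j; rewrite leq_eqVlt => /predU1P[<-//|nj].
  rewrite coefB !coefZ (leq_sizeP _ _ sp) // (leq_sizeP _ _ sps) //.
  by rewrite !mulr0 subrr.
(* The bound for [q] at formal degree n, times [`|t|], is the claim. *)
have := ler_norm_revconj n q t sq q0 t1.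
rewrite -qE horner_revconj // => /(ler_wpM2l (normr_ge0 t)).
rewrite -normrM mulrA -exprS qE; congr (`|_| <= _).
rewrite rmorphB !rmorphM /= !conjCK mulrBr ![_ ^+ _ * (_ * _)]mulrCA.
rewrite -!horner_revconj //; congr (_ * _ - _ * _).
by rewrite revconjK.
Qed.

End UnivariateSchwarzPick.

(** * Disks joining the origin to a point of the polydisk *)

Section Slices.
Context {C : numClosedFieldType} {d : nat}.
Implicit Types (P : mpoly d C) (z : 'rV[C]_d) (N D : 'I_d -> {poly C}).

Lemma leq_multidegree P (m : multinom d) i :
  m \in msupp P -> (m i <= multidegree P i)%N.
Proof.
move=> Pm; rewrite mnmE.
exact: (@leq_bigmax_seq _ _ _ (fun m : multinom d => m i)).
Qed.

Lemma evalv_sum P z :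
  evalv P z = \sum_(m <- msupp P) mcoeff m P * \prod_i z ord0 i ^+ m i.
Proof. by rewrite /evalv mevalE. Qed.

Lemma evalv_reflection_sum P z : evalv (reflection P) z =
  \sum_(m <- msupp P)
    (mcoeff m P)^* * \prod_i z ord0 i ^+ (multidegree P i - m i).
Proof.
have supp : perm_eq (msupp (conj_mpoly P)) (msupp P).
  apply: uniq_perm; rewrite ?msupp_uniq // => m.
  by rewrite !mcoeff_msupp mcoeff_map_mpoly /= conjC_eq0.
rewrite /evalv /reflection raddf_sum (perm_big _ supp) /=.
apply: eq_bigr => m _; rewrite mevalZ mcoeff_map_mpoly mevalX; congr (_ * _).
by apply: eq_bigr => i _; rewrite mnmBE.
Qed.

(** The substitution of the curve [N i / D i] into [P], with the denominators
    cleared up to the multidegree of [P]. *)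
Definition slice P N D : {poly C} := \sum_(m <- msupp P)
  mcoeff m P *: \prod_i (N i ^+ m i * D i ^+ (multidegree P i - m i)).

(** The slice of [reflection P] along the same curve, written over the
    monomials of [P] so that it compares termwise with [slice P N D]. *)
Definition coslice P N D : {poly C} := \sum_(m <- msupp P)
  (mcoeff m P)^* *: \prod_i (D i ^+ m i * N i ^+ (multidegree P i - m i)).

Lemma horner_slice P N D t : (forall i, (D i).[t] != 0) ->
  (slice P N D).[t] = (\prod_i (D i).[t] ^+ multidegree P i) *
    evalv P (\row_i ((N i).[t] / (D i).[t])).
Proof.
move=> D0; rewrite evalv_sum horner_sum mulr_sumr.
rewrite big_seq [RHS]big_seq; apply: eq_bigr => m Pm.
rewrite hornerZ horner_prod mulrCA -big_split /=; congr (_ * _).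
apply: eq_bigr => i _; rewrite mxE hornerM !horner_exp expr_div_n.
by rewrite expfB_cond ?(negbTE (D0 i)) ?leq_multidegree // mulrCA mulrA.
Qed.

Lemma horner_coslice P N D t : (forall i, (D i).[t] != 0) ->
  (coslice P N D).[t] = (\prod_i (D i).[t] ^+ multidegree P i) *
    evalv (reflection P) (\row_i ((N i).[t] / (D i).[t])).
Proof.
move=> D0; rewrite evalv_reflection_sum horner_sum mulr_sumr.
rewrite big_seq [RHS]big_seq; apply: eq_bigr => m Pm.
rewrite hornerZ horner_prod mulrCA -big_split /=; congr (_ * _).
apply: eq_bigr => i _; rewrite mxE hornerM !horner_exp expr_div_n mulrCA.
rewrite mulrC; congr (_ * _).
by rewrite -expfB_cond ?(negbTE (D0 i)) ?leq_subr // subKn ?leq_multidegree.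
Qed.

Lemma size_slice P N D e :
  (forall i, (size (N i) <= e.+1)%N) -> (forall i, (size (D i) <= e.+1)%N) ->
  (size (slice P N D) <= (\sum_i e * multidegree P i).+1)%N.
Proof.
move=> sN sD.
have size_expr (q : {poly C}) k : (size q <= e.+1)%N ->
    (size (q ^+ k) <= (e * k).+1)%N.
  move=> sq; apply: leq_trans (size_poly_exp_leq _ _) _.
  by rewrite ltnS leq_mul // -subn1 leq_subLR add1n.
rewrite /slice big_seq.
elim/big_ind: _ => [|p q sp sq|m Pm]; first by rewrite size_poly0.
  by rewrite (leq_trans (size_polyD _ _)) // geq_max sp.
apply: leq_trans (size_scale_leq _ _) _.
have size_mul (p q : {poly C}) a b : (size p <= a.+1)%N ->
    (size q <= b.+1)%N -> (size (p * q)%R <= (a + b).+1)%N.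
  move=> sp sq; apply: leq_trans (size_polyMleq _ _) _.
  by rewrite -subn1 leq_subLR add1n -addnS -addSn leq_add.
elim/big_ind2: _ => [|? ? ? ?|i _]; first by rewrite size_poly1.
  exact: size_mul.
have -> : (e * multidegree P i = e * m i + e * (multidegree P i - m i))%N.
  by rewrite -mulnDr subnKC // leq_multidegree.
by apply: size_mul; apply: size_expr.
Qed.

(** As [N] and [D] are exchanged by reflection, reflecting a slice exchanges
    the exponents [m i] and [multidegree P i - m i], as [reflection] does. *)
Lemma revconj_slice P N D e :
  (forall i, (size (N i) <= e.+1)%N) -> (forall i, revconj e (N i) = D i) ->
  revconj (\sum_i e * multidegree P i) (slice P N D) = coslice P N D.
Proof.
move=> sN DE.
have sD i : (size (D i) <= e.+1)%N by rewrite -DE size_poly.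
apply: poly_eq_off0 => t t0; rewrite horner_revconj ?size_slice //.
rewrite !horner_sum rmorph_sum mulr_sumr.
rewrite big_seq [RHS]big_seq; apply: eq_bigr => m Pm.
rewrite !hornerZ rmorphM mulrCA; congr (_ * _).
rewrite !horner_prod rmorph_prod -prodrXr -big_split; apply: eq_bigr => i _ /=.
rewrite !hornerM !horner_exp.
have -> : (D i).[t] = t ^+ e * ((N i).[(t^*)^-1])^*.
  by rewrite -horner_revconj // DE.
have -> : (N i).[t] = t ^+ e * ((D i).[(t^*)^-1])^*.
  by rewrite -horner_revconj // -DE revconjK.
rewrite rmorphM !rmorphXn /= !exprMn mulrACA; congr (_ * _).
by rewrite -exprD subnKC ?leq_multidegree // exprM.
Qed.


(** With [m t := (t - r) / (1 - r * t)], the quotient of these two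
    polynomials is [t * (m t + u) / (1 + u^* * m t)]: the product of [t] and
    of a disk automorphism that sends [r] to [u]. It fixes [0] and sends [r]
    to [r * u]. *)
Definition disc_num (r u : C) : {poly C} :=
  'X * ((1 - r * u) *: 'X + (u - r)%:P).

Definition disc_den (r u : C) : {poly C} :=
  (1 - r * u^*)%:P + (u^* - r) *: 'X.

Lemma size_disc_num r u : (size (disc_num r u) <= 3)%N.
Proof.
rewrite /disc_num mulrC; apply: leq_trans (size_polyMleq _ _) _.
rewrite size_polyX addn2 /= ltnS (leq_trans (size_polyD _ _)) // geq_max.
rewrite (leq_trans (size_scale_leq _ _)) ?size_polyX //.
by rewrite (leq_trans (size_polyC_leq1 _)).
Qed.

Lemma revconj_disc_num (r u : C) : r \is Num.real ->
  revconj 2 (disc_num r u) = disc_den r u.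
Proof.
move=> /CrealP rr; apply: poly_eq_off0 => t t0.
rewrite horner_revconj ?size_disc_num // !hornerE.
rewrite !(rmorphM, rmorphD, rmorphN, fmorphV) !rmorph1 /= conjCK rr.
by field.
Qed.

Lemma normB_disc (r u t : C) : r \is Num.real ->
  `|(disc_den r u).[t]| ^+ 2 - `|(1 - r * u) * t + (u - r)| ^+ 2 =
  (1 - `|u| ^+ 2) * (1 - r ^+ 2) * (1 - `|t| ^+ 2).
Proof.
move=> /CrealP rr; rewrite !hornerE !normCK.
by rewrite !(rmorphM, rmorphD, rmorphN) !rmorph1 /= conjCK rr; ring.
Qed.

Lemma ltr_norm_disc (r u t : C) : 0 <= r -> r < 1 -> `|u| < 1 -> `|t| < 1 ->
  `|(disc_num r u).[t]| < `|(disc_den r u).[t]|.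
Proof.
move=> r0 r1 u1 t1.
have lt : `|(1 - r * u) * t + (u - r)| < `|(disc_den r u).[t]|.
  rewrite -ltr_sqr ?nnegrE // -subr_gt0 normB_disc ?ger0_real //.
  by rewrite !mulr_gt0 // subr_gt0 expr_lt1.
apply: le_lt_trans lt.
by rewrite !hornerE normrM ler_piMl // ltW.
Qed.

(** The univariate inequality at [t = r] for the slice of [P] along the disk
    that joins [0] to [z]; the denominators enter both sides only through
    the common factor [A * B] and cancel. *)
Lemma schwarz_pick_reflection P z (r : C) :
  (forall w, polydisk w -> evalv P w != 0) ->
  0 < r -> r < 1 -> (forall i, `|z ord0 i| < r) ->
  `|evalv (reflection P) z| <= `|evalv P z| /\
  `|evalv P 0 * evalv (reflection P) z - evalv (reflection P) 0 * evalv P z| <=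
  r * `|(evalv P 0)^* * evalv P z -
        (evalv (reflection P) 0)^* * evalv (reflection P) z|.
Proof.
move=> P0 r0 r1 zr.
pose u i := z ord0 i / r; pose N i := disc_num r (u i).
pose D i := disc_den r (u i).
have u1 i : `|u i| < 1.
  by rewrite normrM normfV (gtr0_norm r0) ltr_pdivrMr // mul1r.
have ltND (t : C) i : `|t| < 1 -> `|(N i).[t]| < `|(D i).[t]|.
  by move=> t1; rewrite ltr_norm_disc // ltW.
have D0 (t : C) i : `|t| < 1 -> (D i).[t] != 0.
  by move=> /(ltND _ i) lt; rewrite -normr_gt0 (le_lt_trans _ lt).
have sN i : (size (N i) <= 3)%N by exact: size_disc_num.
have ND i : revconj 2 (N i) = D i by rewrite revconj_disc_num ?gtr0_real.
have sD i : (size (D i) <= 3)%N by rewrite -ND size_poly.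
have nz (t : C) : `|t| < 1 -> (slice P N D).[t] != 0.
  move=> t1; rewrite horner_slice => [|i]; last exact: D0.
  rewrite mulf_neq0 //.
    by apply/prodf_neq0 => i _; rewrite expf_neq0 // D0.
  apply: P0 => i; rewrite mxE normrM normfV ltr_pdivrMr ?mul1r ?ltND //.
  by rewrite normr_gt0 D0.
have nr : `|r| < 1 by rewrite gtr0_norm.
have at0 : \row_i ((N i).[0] / (D i).[0]) = 0.
  by apply/rowP => i; rewrite !mxE hornerM hornerX !mul0r.
have atr : \row_i ((N i).[r] / (D i).[r]) = z.
  apply/rowP => i; rewrite !mxE.
  have DE : (D i).[r] = 1 - r ^+ 2 by rewrite /D /disc_den !hornerE; ring.
  have NE : (N i).[r] = r * (u i * (1 - r ^+ 2)).
    by rewrite hornerM hornerX hornerD hornerZ hornerX hornerC; ring.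
  have rr : 1 - r ^+ 2 != 0 by rewrite -DE D0.
  by rewrite DE NE mulrA mulfK // mulrC divfK // gt_eqF.
have sS := size_slice P N D 2 sN sD.
have := ler_norm_revconj _ _ r sS nz nr.
have := schwarz_pick_revconj _ _ r sS nz nr.
rewrite (revconj_slice P N D 2 sN ND).
have t0 : `|0 : C| < 1 by rewrite normr0.
rewrite !horner_slice ?horner_coslice => [| i | i | i | i]; rewrite ?D0 //.
rewrite at0 atr.
set A := \prod_i _; set B := \prod_i _.
have A0 : A != 0 by apply/prodf_neq0 => i _; rewrite expf_neq0 // D0.
have B0 : B != 0 by apply/prodf_neq0 => i _; rewrite expf_neq0 // D0.
set p0 := evalv P 0; set pz := evalv P z.
set s0 := evalv _ 0; set sz := evalv _ z.
move=> sp le; split; first by move: le; rewrite !normrM ler_pM2l ?normr_gt0.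
move: sp; rewrite !rmorphM.
rewrite (_ : _ - _ = (A * B) * (p0 * sz - s0 * pz)); last by ring.
rewrite (_ : A^* * _ * _ - _ = (A^* * B) * (p0^* * pz - s0^* * sz)); last first.
  by ring.
rewrite !normrM norm_conjC (gtr0_norm r0) [r * (_ * _)]mulrCA ler_pM2l //.
by rewrite mulr_gt0 ?normr_gt0.
Qed.

End Slices.

(** * Comparison of the factors with their values at the origin *)

Section PseudohyperbolicBounds.
Context {C : numClosedFieldType}.
Context (r a x : C).
Context (r0 : 0 <= r) (r1 : r < 1) (a0 : 0 <= a) (a1 : a <= 1).
Context (x1 : `|x| <= 1) (rho : `|x - a| <= r * `|1 - a * x|).

(** Since [1 - a x = (1 - x) + x (1 - a)], the hypothesis [rho] bounds
    [`|1 - x|] by [r * `|1 - x|] plus a multiple of [1 - a]. *)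
Lemma ler_norm_1sub_pseudohyperbolic : `|1 - x| * (1 - r) <= (1 + r) * (1 - a).
Proof.
have ha : `|1 - a| = 1 - a by rewrite ger0_norm // subr_ge0.
have h1 : `|1 - a * x| <= `|1 - x| + (1 - a).
  rewrite (_ : 1 - a * x = (1 - x) + x * (1 - a)); last by ring.
  rewrite (le_trans (ler_normD _ _)) // lerD2l normrM ha.
  by rewrite ler_piMl // subr_ge0.
have h2 : `|1 - x| <= r * (`|1 - x| + (1 - a)) + (1 - a).
  rewrite -{1}(subrK a 1) -addrA [_ + (a - x)]addrC.
  rewrite (le_trans (ler_normD _ _)) //.
  by rewrite ha lerD2r distrC (le_trans rho) // ler_wpM2l.
rewrite mulrBr mulr1 lerBlDr (le_trans h2) //.
by rewrite le_eqVlt; apply/orP; left; apply/eqP; ring.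
Qed.

(** By [normB_1subMconj], [rho] means that [(1 - r^2) |1 - a x|^2] is at most
    [(1 - a^2) (1 - |x|^2)]; as [1 - a <= |1 - a x|], one factor [1 - a]
    cancels, and [4] bounds [(1 + a) (1 + |x|)]. *)
Lemma ler_1sub_pseudohyperbolic : (1 - r ^+ 2) * (1 - a) <= 4 * (1 - `|x|).
Proof.
have [->|ane1] := eqVneq a 1; first by rewrite subrr mulr0 mulr_ge0 // subr_ge0.
have a1' : 0 < 1 - a by rewrite subr_gt0 lt_neqAle ane1.
have x1' : 0 <= 1 - `|x| by rewrite subr_ge0.
have lb : 1 - a <= `|1 - a * x|.
  rewrite (le_trans _ (lerB_dist _ _)) // normr1 lerB // normrM ger0_norm //.
  by rewrite ler_piMr.
have := normB_1subMconj a x.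
rewrite (CrealP (ger0_real a0)) (ger0_norm a0) => E.
have : (1 - r ^+ 2) * (1 - a) ^+ 2 <= (1 - a ^+ 2) * (1 - `|x| ^+ 2).
  apply: le_trans (_ : (1 - r ^+ 2) * `|1 - a * x| ^+ 2 <= _).
    apply: ler_wpM2l; first by rewrite subr_ge0 expr_le1 // ltW.
    by rewrite lerXn2r // nnegrE // ltW.
  rewrite -E mulrBl mul1r lerB // -exprMn lerXn2r // nnegrE.
  by rewrite mulr_ge0.
rewrite -[1 - a ^+ 2](_ : (1 - a) * (1 + a) = _); last by ring.
rewrite expr2 mulrCA -mulrA ler_pM2l // => /le_trans; apply.
rewrite -[1 - `|x| ^+ 2](_ : (1 + `|x|) * (1 - `|x|) = _); last by ring.
rewrite mulrA ler_wpM2r // (_ : 4 = (1 + 1) * (1 + 1)); last by ring.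
by rewrite ler_pM ?addr_ge0 ?lerD2l.
Qed.

End PseudohyperbolicBounds.

Section Factors.
Context {C : numClosedFieldType} {d : nat}.
Implicit Types (P : mpoly d C) (z : 'rV[C]_d).

Definition inner_factor P z : C :=
  beta P * (evalv (reflection P) z / evalv P z).

Lemma conj_alpha P : (alpha P)^* = `|alpha P| * beta P.
Proof.
rewrite /beta; case: eqVneq => [->|a0]; first by rewrite conjC0 normr0 mul0r.
by rewrite mulrC divfK // normr_eq0.
Qed.

Lemma norm_beta P : `|beta P| = 1.
Proof.
rewrite /beta; case: eqVneq => [_|a0]; first by rewrite normr1.
by rewrite normrM norm_conjC normfV normr_id divff // normr_eq0.
Qed.

Lemma inner_factor0 P : inner_factor P 0 = `|alpha P|.
Proof.
rewrite /inner_factor -/(alpha P) /beta.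
case: eqVneq => [->|a0]; first by rewrite mulr0 normr0.
by rewrite mulrAC -[_^* * _]mulrC -normCK expr2 mulfK // normr_eq0.
Qed.

(** The inequality for the quotient [P*/P] involves [alpha P] and its
    conjugate; as [(alpha P)^* = `|alpha P| * beta P], multiplying the
    quotient by the unimodular [beta P] replaces both by [`|alpha P|]. *)
Lemma schwarz_pick_inner_factor P z (r : C) :
  (forall w, polydisk w -> evalv P w != 0) ->
  0 < r -> r < 1 -> (forall i, `|z ord0 i| < r) ->
  `|inner_factor P z| <= 1 /\
  `|inner_factor P z - `|alpha P| | <=
    r * `|1 - `|alpha P| * inner_factor P z|.
Proof.
move=> P0 r0 r1 zr; have [le sp] := schwarz_pick_reflection P z r P0 r0 r1 zr.
have pz0 : evalv P z != 0 by apply: P0 => i; rewrite (lt_trans (zr i)).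
have p00 : evalv P 0 != 0 by apply: P0 => i; rewrite mxE normr0 ltr01.
split.
  rewrite normrM norm_beta mul1r normrM normfV ler_pdivrMr ?mul1r //.
  by rewrite normr_gt0.
rewrite -inner_factor0 {1 2}/inner_factor -/(alpha P) -mulrBr normrM norm_beta.
rewrite mul1r inner_factor0 mulrA -conj_alpha.
rewrite /alpha rmorphM fmorphV.
set p0 := evalv P 0 in sp p00 *; set s0 := evalv _ 0 in sp *.
set pz := evalv P z in sp pz0 *; set sz := evalv _ z in sp *.
rewrite (_ : sz / pz - _ = (p0 * sz - s0 * pz) / (p0 * pz)); last first.
  by field; rewrite p00 pz0.
have p00' : p0^* != 0 by rewrite conjC_eq0.
rewrite (_ : 1 - _ = (p0^* * pz - s0^* * sz) / (p0^* * pz)); last first.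
  by field; rewrite p00' pz0.
by rewrite !normrM !normfV !normrM norm_conjC mulrA ler_wpM2r.
Qed.

End Factors.

(** * Locally uniform convergence on the polydisk *)

Section LocallyUniform.
Context {C : numClosedFieldType} {d : nat}.
Implicit Types (F : nat -> 'rV[C]_d -> C) (g : 'rV[C]_d -> C).

(** The sets [|z_i| < r], for [r < 1] close to [1], form an increasing open
    cover of the polydisk. *)
Lemma compact_polydisk_radius (K : set 'rV[C]_d) :
  compact K -> K `<=` polydisk ->
  exists r : C, [/\ 0 < r, r < 1 & forall z, K z -> forall i, `|z ord0 i| < r].
Proof.
move=> /compact_near_coveringP cK KD.
have near_r : \forall r \near (1 : C)^'-,
    K `<=` (fun z : 'rV[C]_d => forall i, `|z ord0 i| < r).
  apply: (cK _ _ (fun r z => forall i, `|z ord0 i| < r)) => x /KD xD.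
  have near_i (i : 'I_d) : filter_prod (nbhs x) (1 : C)^'-
      (fun p => `|p.1 ord0 i| < p.2); last exact: filter_forall near_i.
  (* Moving z_i by less than e and r by less than e keeps |z_i| < r. *)
  pose e : C := (1 - `|x ord0 i|) / 2.
  have e0 : 0 < e by rewrite divr_gt0 ?subr_gt0 ?xD.
  exists ([set z : 'rV[C]_d | `|x ord0 i - z ord0 i| < e],
          [set r : C | r < 1 /\ `|1 - r| < e]).
    split=> /=.
      have := @coord_continuous C 1 d ord0 i x.
      by move=> /cvgr_dist_lt /(_ e e0).
    apply: filterI; first exact: nbhs_left_lt.
    apply/nbhs_ballP; exists e; first by [].
    by move=> r; rewrite -ball_normE.
  move=> [z r] /= [xz [r1 rx]].
  rewrite gtr0_norm ?subr_gt0 // in rx.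
  rewrite -(subrK (x ord0 i) (z ord0 i)).
  rewrite (le_lt_trans (ler_normD _ _)) // distrC.
  rewrite -ltrBrDr (lt_trans xz) // ltrBrDr addrC -ltrBrDr.
  rewrite (_ : `|x ord0 i| = 1 - e - e); last by rewrite /e; field.
  by rewrite ltrBDr addrAC subrK ltrBlDr -ltrBlDl.
have near_0 : \forall r \near (1 : C)^'-, 0 < r by apply: nbhs_left_gt.
have near_1 : \forall r \near (1 : C)^'-, r < 1 by apply: nbhs_left_lt.
have [r [[? ?] ?]] := filter_ex (filterI (filterI near_0 near_1) near_r).
by exists r; split.
Qed.

Lemma family_cvg_dist_lt F g z (e : C) :
  {family [set K | compact K /\ K `<=` polydisk], F @ \oo --> g} ->
  polydisk z -> 0 < e -> \forall N \near \oo, `|g z - F N z| < e.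
Proof.
move=> /fam_cvgP Fg zD e0.
have /Fg Fz : [set K | compact K /\ K `<=` polydisk] [set z].
  by split; [exact: compact_set1 | move=> _ ->].
apply: (Fz [set h | `|g z - h z| < e]); apply/uniform_nbhs.
exists [set xy | `|xy.1 - xy.2| < e]; split; last by move=> h /(_ z erefl).
rewrite -entourage_ballE; by exists e.
Qed.

Lemma family_cvg_dist_lt_uniform F g :
  (forall r e : C, 0 < r -> r < 1 -> 0 < e -> \forall N \near \oo,
     forall z : 'rV[C]_d, (forall i, `|z ord0 i| < r) -> `|g z - F N z| < e) ->
  {family [set K | compact K /\ K `<=` polydisk], F @ \oo --> g}.
Proof.
move=> Fg; apply/fam_cvgP => K [/compact_polydisk_radius cK /cK[r [r0 r1 Kr]]].
move=> A /uniform_nbhs[E [+ EA]].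
rewrite -entourage_ballE => -[e e0 eE].
apply: filterS (Fg r e r0 r1 e0) => N HN; apply: EA => z /Kr /HN lt.
by apply: eE; rewrite /= -ball_normE.
Qed.

End LocallyUniform.

(** * Partial products and complex limits *)

Section PartialProducts.
Context {C : numClosedFieldType}.
Context (f : nat -> C) (f1 : forall n, `|f n| <= 1).

Lemma ler_norm_prod M N : (M <= N)%N ->
  `|\prod_(n < N) f n| <= `|\prod_(n < M) f n|.
Proof.
elim: N => [|N IH]; first by rewrite leqn0 => /eqP->.
rewrite leq_eqVlt => /predU1P[->//|]; rewrite ltnS => /IH; apply: le_trans.
by rewrite big_ord_recr /= normrM ler_piMr.
Qed.

(** The error is relative to the product up to [M]: this is what keeps the
    limit of the products away from [0]. *)
Lemma ler_norm_prodB M N : (M <= N)%N ->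
  `|\prod_(n < N) f n - \prod_(n < M) f n| <=
    `|\prod_(n < M) f n| * \sum_(M <= n < N) `|1 - f n|.
Proof.
elim: N => [|N IH].
  by rewrite leqn0 => /eqP->; rewrite subrr normr0 big_geq // mulr0.
rewrite leq_eqVlt => /predU1P[->|].
  by rewrite subrr normr0 big_geq ?mulr0.
rewrite ltnS => MN; rewrite big_ord_recr big_nat_recr //= mulrDr.
set G := \prod_(n < N) f n; set H := \prod_(n < M) f n.
rewrite (_ : G * f N - H = (G - H) - G * (1 - f N)); last by ring.
rewrite (le_trans (ler_normB _ _)) // lerD ?IH // normrM ler_wpM2r //.
exact: ler_norm_prod.
Qed.

(** Telescoping: [c * (1 - `|f n|)] is at most the decrease of the modulus of
    the product when [f n] is multiplied in. *)
Lemma sum_1sub_norm_le c N : 0 <= c -> c <= `|\prod_(n < N) f n| ->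
  c * \sum_(n < N) (1 - `|f n|) <= 1 - `|\prod_(n < N) f n|.
Proof.
move=> c0; elim: N => [|N IH] cN; first by rewrite !big_ord0 mulr0 normr1 subrr.
have {}cN := le_trans cN (ler_norm_prod _ _ (leqnSn N)).
rewrite !big_ord_recr /= mulrDr normrM.
set G := `|_| in IH cN *.
rewrite (_ : 1 - G * _ = (1 - G) + G * (1 - `|f N|)); last by ring.
by rewrite lerD ?IH // ler_wpM2r // subr_ge0.
Qed.

End PartialProducts.

Section ComplexLimits.
Context {R : realType}.
Local Notation C := R[i].
Local Notation normc := (@ComplexField.Normc.normc R).

Lemma norm_complexE (x : C) : `|x| = (normc x)%:C%C.
Proof. by rewrite normc_def; case: x. Qed.

(** The limit in the complex plane, taken coordinatewise from the complete
    space [R]. *)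
Definition clim (u : nat -> C) : C :=
  Complex (limn (fun n => complex.Re (u n))) (limn (fun n => complex.Im (u n))).

Lemma cvg_of_tail_bound (v e : nat -> R) :
  (forall M N, (M <= N)%N -> `|v N - v M| <= e M) -> e @ \oo --> (0 : R) ->
  cvgn v.
Proof.
move=> ve e0; apply: cauchy_cvg; apply: cauchy_exP => eps eps0.
have /filter_ex[M eM] : \forall M \near \oo, `|0 - e M| < eps.
  exact: (cvgr_dist_lt _ _ e0).
exists (v M); exists M => //= N /= MN; rewrite -ball_normE /= distrC.
rewrite (le_lt_trans (ve _ _ MN)) // (le_lt_trans _ eM) //.
by rewrite sub0r normrN ler_norm.
Qed.

Lemma lim_dist_le (v : nat -> R) M b : cvgn v ->
  (forall N, (M <= N)%N -> `|v N - v M| <= b) -> `|limn v - v M| <= b.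
Proof.
move=> cv vb.
have h : (fun N => `|v N - v M|) @ \oo --> `|limn v - v M|.
  by apply: cvg_norm; apply: cvgB => //; exact: cvg_cst.
rewrite -(cvg_lim _ h) //; apply: limr_le.
  by apply/cvg_ex; eexists; exact: h.
by exists M => // N /= /vb.
Qed.

Lemma ler_norm_Re_Im (x : C) (b : R) :
  `|x| <= b%:C%C -> `|complex.Re x| <= b /\ `|complex.Im x| <= b.
Proof.
rewrite normc_def lecR => xb.
have b0 : 0 <= b by rewrite (le_trans _ xb) // sqrtr_ge0.
split; rewrite (le_trans _ xb) // -sqrtr_sqr ler_sqrt ?addr_ge0 ?sqr_ge0 //.
  by rewrite lerDl sqr_ge0.
by rewrite lerDr sqr_ge0.
Qed.

(** The bound [e] gives the convergence; [b] may be sharper at the given [M].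
    The factor 2 comes from adding the errors on the real and imaginary
    parts. *)
Lemma clim_dist_le (u : nat -> C) (e : nat -> R) :
  (forall M N, (M <= N)%N -> `|u N - u M| <= (e M)%:C%C) ->
  e @ \oo --> (0 : R) ->
  forall M (b : R), (forall N, (M <= N)%N -> `|u N - u M| <= b%:C%C) ->
  `|clim u - u M| <= (2 * b)%:C%C.
Proof.
move=> ue e0 M b ub.
have ReB x y : complex.Re (x - y) = complex.Re x - complex.Re y :> R.
  by case: x; case: y.
have ImB x y : complex.Im (x - y) = complex.Im x - complex.Im y :> R.
  by case: x; case: y.
have hRe : `|limn (fun n => complex.Re (u n)) - complex.Re (u M)| <= b.
  apply: lim_dist_le => [|N /ub/ler_norm_Re_Im[]]; last by rewrite ReB.
  by apply: cvg_of_tail_bound e0 => ? ? /ue/ler_norm_Re_Im[]; rewrite ReB.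
have hIm : `|limn (fun n => complex.Im (u n)) - complex.Im (u M)| <= b.
  apply: lim_dist_le => [|N /ub/ler_norm_Re_Im[]]; last by rewrite ImB.
  by apply: cvg_of_tail_bound e0 => ? ? /ue/ler_norm_Re_Im[]; rewrite ImB.
rewrite [clim u - u M]complexE (le_trans (ler_normD _ _)) //.
rewrite normrM ReB ImB /= !normc_def /= expr0n /= expr1n addr0 add0r.
rewrite addr0 sqrtr1 mul1r !sqrtr_sqr -[_ + _]rmorphD lecR.
by rewrite mulr_natl mulr2n lerD.
Qed.

End ComplexLimits.

(** * Nonvanishing of reflections *)

Section Nonvanishing.
Context {C : numClosedFieldType} {d : nat}.
Implicit Types (P : mpoly d C).

(** At [1], the restriction of the reflection to the diagonal is conjugate to
    the value of [P] at [(1, ..., 1)], a point of the distinguished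
    boundary. *)
Lemma reflection_diagonal_neq0 P :
  (forall w, distinguished_boundary w -> evalv P w != 0) ->
  slice (reflection P) (fun=> 'X) (fun=> 1) != 0.
Proof.
move=> P0; apply/eqP => /(congr1 (fun q => q.[1])).
rewrite horner0 horner_slice => [|i]; last by rewrite hornerC oner_eq0.
rewrite big1 => [|i _]; last by rewrite hornerC expr1n.
rewrite mul1r evalv_reflection_sum => /(congr1 Num.conj).
rewrite conjC0 rmorph_sum /= => E.
have /P0/negP : @distinguished_boundary C d (const_mx 1).
  by move=> i; rewrite mxE normr1.
apply; rewrite evalv_sum -[X in _ == X]E; apply/eqP; apply: eq_bigr => m _.
rewrite rmorphM /= conjCK !big1 ?conjC1 // => i _.
  by rewrite !mxE hornerX hornerC divr1 expr1n.
by rewrite mxE expr1n.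
Qed.

(** On the diagonal, the product of the [M] reflections is a nonzero
    univariate polynomial, so it does not vanish at all the points
    [1 / (k + 3)]. *)
Lemma exists_reflections_neq0 (P : nat -> mpoly d C) M :
  (forall n w, distinguished_boundary w -> evalv (P n) w != 0) ->
  exists z : 'rV[C]_d, (forall i, `|z ord0 i| < 2^-1) /\
    forall n, (n < M)%N -> evalv (reflection (P n)) z != 0.
Proof.
move=> P0.
pose q := \prod_(n < M) slice (reflection (P n)) (fun=> 'X) (fun=> 1).
have q0 : q != 0.
  by apply/prodf_neq0 => n _; apply: reflection_diagonal_neq0; exact: P0.
have [|k] := exists_nonroot _ (fun k : nat => k.+3%:R^-1 : C) q0.
  by move=> i j /invr_inj /eqP; rewrite eqr_nat !eqSS => /eqP.
rewrite horner_prod => /prodf_neq0 qk.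
exists (const_mx k.+3%:R^-1); split=> [i|n nM].
  by rewrite mxE normfV normr_nat ltf_pV2 ?posrE ?ltr0n // ltr_nat.
have := qk (Ordinal nM) isT.
rewrite horner_slice => [|i]; last by rewrite hornerC oner_eq0.
rewrite mulf_eq0 negb_or => /andP[_]; congr (evalv _ _ != 0).
by apply/rowP => i; rewrite !mxE hornerX hornerC divr1.
Qed.

End Nonvanishing.

(** * Convergence of the product *)

Section Product.
Context {R : realType} {d : nat}.
Local Notation C := (R[i] : numClosedFieldType).
Local Notation normc := (@ComplexField.Normc.normc R).
Context (P : nat -> mpoly d C) (hP : forall n, admissible (P n)).

Local Notation a n := (normc (alpha (P n))).
Local Notation f n z := (inner_factor (P n) z).
Local Notation G N z := (\prod_(n < N) inner_factor (P n) z).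

Let P0 n (w : 'rV[C]_d) : polydisk w -> evalv (P n) w != 0.
Proof. by case: (hP n) => _ h _ wD; apply: h; left. Qed.

Let Pbd0 n (w : 'rV[C]_d) : distinguished_boundary w -> evalv (P n) w != 0.
Proof. by case: (hP n) => _ h _ wD; apply: h; right. Qed.

Let polydisk_radius (z : 'rV[C]_d) : polydisk z ->
  exists r : C, [/\ 0 < r, r < 1 & forall i, `|z ord0 i| < r].
Proof.
move=> zD; have zK : [set z] `<=` @polydisk C d by move=> _ ->.
have [r [r0 r1 zr]] := compact_polydisk_radius _ (@compact_set1 _ z) zK.
by exists r; split=> //; apply: zr.
Qed.

Let norm_f n (z : 'rV[C]_d) : polydisk z -> `|f n z| <= 1.
Proof.
move=> /polydisk_radius[r [r0 r1 zr]].
by have [] := schwarz_pick_inner_factor (P n) z r (P0 n) r0 r1 zr.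
Qed.

Let zeroD : @polydisk C d 0.
Proof. by move=> i; rewrite mxE normr0 ltr01. Qed.

Let norm_alpha n : `|alpha (P n)| <= 1.
Proof. by rewrite -normr_id -inner_factor0 norm_f. Qed.

Let a_le1 n : 0 <= 1 - a n.
Proof. by rewrite subr_ge0 -lecR -norm_complexE. Qed.

Let a_complexE n : (1 - a n)%:C%C = 1 - `|alpha (P n)|.
Proof. by rewrite norm_complexE rmorphB rmorph1. Qed.

(** Lower bounds on the partial products at one point bound the sum of the
    [1 - `|f n z|] there, and the Schwarz-Pick inequality carries this bound
    to the origin, where [f n 0] is [a n]. *)
Lemma summable_of_product_converges :
  infinite_product_converges (fun n z => f n z) ->
  (\sum_(0 <= n <oo) (1 - a n)%:E < +oo)%E.
Proof.
move=> [g [Gg [z zD gz]]].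
have [r [r0 r1 zr]] := polydisk_radius z zD.
pose c : C := `|g z| / 2.
have c0 : 0 < c by rewrite divr_gt0 // normr_gt0.
have [M _ GM] := family_cvg_dist_lt _ _ z c Gg zD c0.
have fz1 n : `|f n z| <= 1 by exact: norm_f.
have cG N : c <= `|G N z|.
  apply: le_trans (ler_norm_prod _ fz1 _ _ (leq_maxr M N)).
  have /GM lt : (M <= maxn M N)%N by exact: leq_maxl.
  have := le_lt_trans (lerB_dist _ _) lt.
  rewrite ltrBlDr -ltrBlDl (_ : `|g z| - c = c); last by rewrite /c; field.
  by move/ltW.
have r2 : 0 < 1 - r ^+ 2 by rewrite subr_gt0 expr_lt1 // ltW.
have bound N : (\sum_(n < N) (1 - a n))%:C%C <= 4 / (c * (1 - r ^+ 2)).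
  rewrite rmorph_sum ler_pdivlMr ?(mulr_gt0 c0 r2) // [c * _]mulrC.
  rewrite mulrA mulr_suml.
  apply: le_trans (_ : (4 * \sum_(n < N) (1 - `|f n z|)) * c <= _).
    rewrite ler_wpM2r ?(ltW c0) // mulr_sumr ler_sum // => n _.
    rewrite /= a_complexE mulrC.
    have [f1 sp] := schwarz_pick_inner_factor (P n) z r (P0 n) r0 r1 zr.
    exact: ler_1sub_pseudohyperbolic (ltW r0) r1 _ (norm_alpha n) f1 sp.
  rewrite -mulrA -[leRHS]mulr1 ler_wpM2l // mulrC.
  apply: le_trans (sum_1sub_norm_le _ fz1 _ _ (ltW c0) (cG N)) _.
  by rewrite gerBl.
apply: le_lt_trans (ltry (complex.Re (4 / (c * (1 - r ^+ 2))))).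
apply: lime_le; first by apply: is_cvg_nneseries => n _ _; rewrite lee_fin.
apply: nearW => N; rewrite sumEFin lee_fin big_mkord.
by have := bound N; rewrite lecE => /andP[].
Qed.

(** The distance of [G N] to [G M] is at most [`|G M|] times a multiple of the
    tail of the sum, uniformly on smaller polydisks; the limit inherits this
    bound, which gives both the convergence and the nonvanishing. *)
Lemma product_converges_of_summable :
  (\sum_(0 <= n <oo) (1 - a n)%:E < +oo)%E ->
  infinite_product_converges (fun n z => f n z).
Proof.
move=> /(nnseries_is_cvg a_le1) sl.
set s := series _ in sl.
have s_nd : {homo s : m n / (m <= n)%N >-> m <= n}.
  by apply: nondecreasing_series => n _ _.
(* e M is the tail of the sum of the 1 - a n from the index M on. *)
pose e M := limn s - s M.
have e0 : e @ \oo --> (0 : R).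
  by rewrite -(subrr (limn s)); apply: cvgB => //; exact: cvg_cst.
have tail M N : (M <= N)%N -> \sum_(M <= n < N) (1 - a n) <= e M.
  move=> MN; rewrite -sub_series_geq // lerB //.
  exact: nondecreasing_cvgn_le.
have e_ge0 M : 0 <= e M by rewrite subr_ge0 nondecreasing_cvgn_le.
have disc (r : C) : 0 < r -> r < 1 -> exists2 k : R, 0 < k &
    forall z : 'rV[C]_d, (forall i, `|z ord0 i| < r) ->
    forall M N, (M <= N)%N -> `|G N z - G M z| <= `|G M z| * (k * e M)%:C%C.
  (* The constant of [ler_norm_1sub_pseudohyperbolic], read as a real number. *)
  move=> r0 r1; pose k := (1 + r) / (1 - r).
  have r1' : 0 < 1 - r by rewrite subr_gt0.
  have k0 : 0 < k by rewrite divr_gt0 // addr_gt0.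
  have kE : (complex.Re k)%:C%C = k by rewrite RRe_real // gtr0_real.
  exists (complex.Re k) => [|z zr M N MN]; first by rewrite -ltcR kE.
  have zD : polydisk z by move=> i; rewrite (lt_trans (zr i)).
  apply: le_trans (ler_norm_prodB _ (fun n => norm_f n z zD) _ _ MN) _.
  rewrite ler_wpM2l //.
  apply: le_trans (_ : \sum_(M <= n < N) k * (1 - a n)%:C%C <= _).
    apply: ler_sum => n _; rewrite a_complexE.
    have [f1 sp] := schwarz_pick_inner_factor (P n) z r (P0 n) r0 r1 zr.
    rewrite /k mulrAC ler_pdivlMr //.
    exact: ler_norm_1sub_pseudohyperbolic (ltW r0) (norm_alpha n) f1 sp.
  rewrite -mulr_sumr -[\sum_(_ <= _ < _) _]rmorph_sum rmorphM /= kE.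
  by rewrite ler_pM2l // lecR tail.
have G1 (z : 'rV[C]_d) M : polydisk z -> `|G M z| <= 1.
  move=> zD; have := ler_norm_prod _ (fun n => norm_f n z zD) _ _ (leq0n M).
  by rewrite big_ord0 normr1.
have cauchy_G (r : C) : 0 < r -> r < 1 -> exists2 k : R, 0 < k &
    forall z : 'rV[C]_d, (forall i, `|z ord0 i| < r) ->
      (forall M N, (M <= N)%N -> `|G N z - G M z| <= (k * e M)%:C%C) /\
      forall M, `|clim (fun N => G N z) - G M z| <=
        `|G M z| * (2 * (k * e M))%:C%C.
  move=> r0 r1; have [k k0 rk] := disc r r0 r1; exists k => // z zr.
  have zD : polydisk z by move=> i; rewrite (lt_trans (zr i)).
  have GG M N : (M <= N)%N -> `|G N z - G M z| <= (k * e M)%:C%C.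
    move=> MN; apply: le_trans (rk z zr M N MN) _.
    by rewrite ler_piMl ?G1 // ler0c mulr_ge0 // ltW.
  split=> // M; rewrite [`|G M z|]norm_complexE -rmorphM /= mulrCA.
  apply: (clim_dist_le (fun N => G N z) (fun M => k * e M)) => //.
    by rewrite -(mulr0 k); apply: cvgM => //; exact: cvg_cst.
  by move=> N MN; rewrite rmorphM /= -norm_complexE rk.
exists (fun z => clim (fun N => G N z)); split.
  apply: family_cvg_dist_lt_uniform => r eps r0 r1 eps0.
  have [k k0 rk] := cauchy_G r r0 r1.
  have epsE : (complex.Re eps)%:C%C = eps by rewrite RRe_real // gtr0_real.
  have ke0 : (fun M => 2 * (k * e M)) @ \oo --> (0 : R).
    rewrite -(mulr0 2); apply: cvgM; first exact: cvg_cst.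
    by rewrite -(mulr0 k); apply: cvgM => //; exact: cvg_cst.
  have eps0' : 0 < complex.Re eps by rewrite -ltcR epsE.
  apply: filterS (cvgr_dist_lt _ _ ke0 _ eps0') => M.
  rewrite sub0r normrN => ltM z zr; have [_ cl] := rk z zr.
  have zD : polydisk z by move=> i; rewrite (lt_trans (zr i)).
  apply: le_lt_trans (cl M) _; rewrite -epsE.
  apply: le_lt_trans (_ : (2 * (k * e M))%:C%C < _).
    by rewrite ler_piMl ?G1 // ler0c !mulr_ge0 // ltW.
  by rewrite ltcR (le_lt_trans (ler_norm _)).
(* The limit is nonzero at a point z with |z_i| < 1/2 where G M z != 0, once M
   is so large that the relative error is less than 1. *)
have h0 : 0 < 2^-1 :> C by rewrite invr_gt0 ltr0n.
have h1 : 2^-1 < 1 :> C by rewrite invf_lt1 ?ltr1n // ltr0n.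
have [k k0 rk] := cauchy_G 2^-1 h0 h1.
have ke0 : (fun M => 2 * (k * e M)) @ \oo --> (0 : R).
  rewrite -(mulr0 2); apply: cvgM; first exact: cvg_cst.
  by rewrite -(mulr0 k); apply: cvgM => //; exact: cvg_cst.
have /filter_ex[M] : \forall M \near \oo, `|0 - 2 * (k * e M)| < 1.
  exact: cvgr_dist_lt ke0 _ ltr01.
rewrite sub0r normrN => /(le_lt_trans (ler_norm _)) ltM.
have [z [zr Pz]] := exists_reflections_neq0 P M Pbd0.
have zD : polydisk z by move=> i; rewrite (lt_trans (zr i)).
exists z => //; apply/eqP => lim0.
have [_ /(_ M)] := rk z zr; rewrite lim0 sub0r normrN.
have GM0 : G M z != 0.
  apply/prodf_neq0 => n _; rewrite !mulf_neq0 ?invr_eq0 ?P0 ?Pz //.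
  by rewrite -normr_eq0 norm_beta oner_eq0.
rewrite -[leLHS]mulr1 ler_pM2l ?normr_gt0 // -(rmorph1 (real_complex R)).
by rewrite lecR leNgt ltM.
Qed.

End Product.

Theorem theorem1 (R : realType) (d : nat) (hd : (0 < d)%N)
    (P : nat -> mpoly d (R[i] : numClosedFieldType))
    (hP : forall n, admissible (P n)) :
  infinite_product_converges
    (fun n z => beta (P n) * (evalv (reflection (P n)) z / evalv (P n) z))
  <->
  (\sum_(0 <= n <oo) (1 - ComplexField.Normc.normc (alpha (P n)))%:E < +oo)%E.
Proof.
split.
  exact: summable_of_product_converges.
exact: product_converges_of_summable.
Qed.
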